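(* Let $k$ be a positive integer. An $n$-qubit permutation gate $\pi$ is a semi-Clifford gate in $\mathcal{C}_{k+1}$ if and only if there exist Clifford permutations $\phi_1,\phi_2$ and a mismatch-free product $\mu$ of multi-controlled NOT gates such that $\pi=\phi_1\mu\phi_2$ and each gate in $\mu$ has at most $k$ controls.
   Context: Gates on $n$ qubits are unitary operators on $(\mathbb{C}^2)^{\otimes n}$, with computational basis $\{|v\rangle : v\in\mathbb{F}_2^n\}$. The Pauli group $\mathcal{P}_n$ consists of all $cP_1\otimes\cdots\otimes P_n$ with $c\in\{\pm1,\pm i\}$ and $P_j\in\{I_2,X,Y,Z\}$. The Clifford hierarchy: $\mathcal{C}_1=\mathcal{P}_n$, and for $m\ge2$, $\mathcal{C}_m$ is the set of unitaries $U$ with $UPU^\dagger\in\mathcal{C}_{m-1}$ for all $P\in\mathcal{P}_n$. $\mathcal{C}_2$ is the Clifford group. A permutation gate is a unitary whose matrix in the computational basis is a permutation matrix; a Clifford permutation is a permutation gate in $\mathcal{C}_2$. A gate is semi-Clifford if it equals $\phi_1d\phi_2$ for some Clifford gates $\phi_1,\phi_2$ and some gate $d$ that is diagonal in the computational basis. A multi-controlled NOT gate (a $C^mX$ gate, for some $m\ge0$) has a target qubit $t$ and a set $K\subseteq[n]\setminus\{t\}$ of $m$ control qubits, and is the permutation gate replacing $a_t$ by $a_t+\prod_{i\in K}a_i$ and fixing the other coordinates (for $m=0$ it is $X_t$). A (possibly empty) product of such gates is mismatch-free if no qubit is used as a target by one gate and as a control by another gate of the product (equivalently, the gates pairwise commute).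 *)

(* Defs.v *)
From HB Require Import structures.
From mathcomp Require Import all_boot all_order all_algebra.
From mathcomp Require Import spectral.
From mathcomp Require Export reals complex.

Set Implicit Arguments.
Unset Strict Implicit.
Unset Printing Implicit Defensive.

Import GRing.Theory Num.Theory.
Local Open Scope ring_scope.
Local Open Scope sesquilinear_scope.

Definition bits (n : nat) : finType := 'rV['F_2]_n.

(* Square matrices over C whose rows and columns are labelled by F_2^n, through
   the enumeration [enum_val : 'I_#|bits n| -> bits n] of the basis. *)
Definition op (C : numClosedFieldType) (n : nat) := 'M[C]_#|bits n|.

(* The operator with entries <v|U|w> = f v w. *)
Definition op_of (C : numClosedFieldType) (n : nat)
    (f : bits n -> bits n -> C) : op C n :=
  \matrix_(i, j) f (enum_val i) (enum_val j).

Definition is_gate (C : numClosedFieldType) (n : nat) (U : op C n) : Prop :=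
  U \is unitarymx.

Definition pauliX (C : numClosedFieldType) : 'M[C]_2 :=
  \matrix_(i < 2, j < 2) (i != j)%:R.

(* Y = [[0, -i], [i, 0]] *)
Definition pauliY (C : numClosedFieldType) : 'M[C]_2 :=
  \matrix_(i < 2, j < 2)
    if i == j then 0 else if (i < j)%N then - 'i else 'i.

Definition pauliZ (C : numClosedFieldType) : 'M[C]_2 :=
  \matrix_(i < 2, j < 2) if i == j then (-1) ^+ i else 0.

(* P_1 (x) ... (x) P_n; a bit of type 'F_2 is (convertibly) an index in 'I_2. *)
Definition tensor (C : numClosedFieldType) (n : nat)
    (P : 'I_n -> 'M[C]_2) : op C n :=
  op_of (fun v w => \prod_(j < n) P j (v 0 j) (w 0 j)).

Definition is_pauli (C : numClosedFieldType) (n : nat) (U : op C n) : Prop :=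
  exists (c : C) (P : 'I_n -> 'M[C]_2),
    [/\ c \in [:: 1; -1; 'i; - 'i],
        forall j, P j \in [:: 1%:M; pauliX C; pauliY C; pauliZ C]
      & U = c *: tensor P].

(* [clifford_level m] is C_m for m >= 1; there is no C_0, and
   [clifford_level 0] is empty by convention. *)
Fixpoint clifford_level (C : numClosedFieldType) (n m : nat) (U : op C n)
    : Prop :=
  match m with
  | 0 => False
  | m'.+1 =>
      if m' is 0 then is_pauli U
      else is_gate U /\
           forall P : op C n, is_pauli P -> clifford_level m' (U *m P *m U^t*)
  end.

Definition is_clifford (C : numClosedFieldType) (n : nat) (U : op C n) : Prop :=
  clifford_level 2 U.

Definition is_perm_gate (C : numClosedFieldType) (n : nat) (U : op C n)
    : Prop :=
  is_gate U /\ is_perm_mx U.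

Definition is_clifford_perm (C : numClosedFieldType) (n : nat) (U : op C n)
    : Prop :=
  is_perm_gate U /\ is_clifford U.

Definition is_diag_gate (C : numClosedFieldType) (n : nat) (U : op C n)
    : Prop :=
  is_gate U /\ is_diag_mx U.

Definition is_semi_clifford (C : numClosedFieldType) (n : nat) (U : op C n)
    : Prop :=
  exists phi1 d phi2 : op C n,
    [/\ is_clifford phi1, is_diag_gate d, is_clifford phi2
      & U = phi1 *m d *m phi2].

Record mcnot (n : nat) := MCNot {
  target : 'I_n;
  controls : {set 'I_n};
  target_notin_controls : target \notin controls
}.

Definition mcnot_fun (n : nat) (g : mcnot n) (a : bits n) : bits n :=
  \row_j (a 0 j + if j == target g then \prod_(i in controls g) a 0 i else 0).

(* |a> |-> |mcnot_fun g a> *)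
Definition mcnot_gate (C : numClosedFieldType) (n : nat) (g : mcnot n)
    : op C n :=
  op_of (fun v w => (v == mcnot_fun g w)%:R).

Definition mcnot_prod (C : numClosedFieldType) (n : nat) (s : seq (mcnot n))
    : op C n :=
  \big[mulmx/1%:M]_(g <- s) mcnot_gate C g.

(* Taking g = h, or two occurrences of the same gate, imposes nothing, by
   [target_notin_controls]. *)
Definition mismatch_free (n : nat) (s : seq (mcnot n)) : bool :=
  allrel (fun g h => target g \notin controls h) s s.

(* Main.v *)
(* Write X^a Z^b for a Pauli operator up to phase. If pi = phi1 d phi2 is
   semi-Clifford, conjugation by pi carries the Lagrangian family phi2^-1
   Z^c phi2 = X^(cM) Z^(cN) to Paulis X^(cM') Z^(cN'). As pi permutes the
   basis, this says that pi(v + cM) = pi(v) + cM' and that the linear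
   forms cN and cN' o pi agree up to a constant. In suitable affine
   coordinates pi therefore commutes with translations along some
   coordinates T and fixes the others, so it is a shear w |-> w + f(w)
   with values in the T-coordinates and depending on the other ones only;
   expanding f in monomials gives a mismatch-free product. For the number
   of controls, conjugate Z_t by the shear: this is the diagonal gate with
   signs (-1)^(w_t + f_t(w)), and the diagonal gate with signs (-1)^g lies
   in C_m exactly when deg g <= m, degree being defined by iterated
   derivatives, since conjugating X^a by it yields the derivative of g
   along a. Conversely, Hadamard gates on the targets turn a mismatch-free
   product into the diagonal gate of v |-> v . f(v), whose degree is at
   most k + 1. *)

Require Import Defs.
From mathcomp Require Import all_boot all_order all_algebra.
From mathcomp Require Import fingroup perm spectral reals complex ring.

Set Implicit Arguments.
Unset Strict Implicit.
Unset Printing Implicit Defensive.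

Import GRing.Theory Num.Theory.
Local Open Scope ring_scope.
Local Open Scope sesquilinear_scope.

(** * Linear normal form *)

Lemma eq_mulmx_rowvec (F : nzRingType) m n (A B : 'M[F]_(m, n)) :
  (forall c : 'rV_m, c *m A = c *m B) -> A = B.
Proof. by move=> AB; apply/row_matrixP=> i; rewrite !rowE AB. Qed.

Section NormalForm.
Variables (F : fieldType) (n : nat) (h : 'rV[F]_n -> 'rV[F]_n).
Variables (M N M' N' : 'M[F]_n) (s : 'rV[F]_n).
Hypothesis h_inj : injective h.
Hypothesis hM : forall v c, h (v + c *m M) = h v + c *m M'.
Hypothesis hN : forall v, v *m N^T = h v *m N'^T + s.
Hypothesis MN : M *m N^T = N *m M^T.
Hypothesis MN_inj : forall c : 'rV_n, c *m M = 0 -> c *m N = 0 -> c = 0.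

(** Evaluating [hM] at 0 gives [h (c *m M) = h 0 + c *m M'], and [h] is injective. *)
Lemma translation_ker (c : 'rV_n) : c *m M = 0 <-> c *m M' = 0.
Proof.
split=> cM; have := hM 0 c; rewrite cM addr0.
  by move/(congr1 (fun x => x - h 0)); rewrite subrr addrC addKr.
by move/h_inj; rewrite add0r.
Qed.

Lemma translation_ker_mx m (A : 'M_(m, n)) : A *m M = 0 <-> A *m M' = 0.
Proof.
split=> AM; apply/row_matrixP=> i; rewrite row_mul row0; apply/translation_ker;
by rewrite -row_mul AM row0.
Qed.

Lemma translation_rank : \rank M' = \rank M.
Proof.
have e : \rank (kermx M') = \rank (kermx M).
  apply/eqP; rewrite eqn_leq; apply/andP; split; apply: mxrankS;
  by apply/sub_kermxP/translation_ker_mx/mulmx_ker.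
move: e; rewrite !mxrank_ker => e.
by rewrite -[LHS](subKn (rank_leq_row M')) e subKn // rank_leq_row.
Qed.

(** Comparing [hN] at [c *m M] and at 0 eliminates [s], while [hM] turns the difference of the two
    images into [c *m M']. *)
Lemma translation_form : M *m N^T = M' *m N'^T.
Proof.
apply: eq_mulmx_rowvec => c.
have := hN (0 + c *m M); rewrite hM !mulmxDl mul0mx add0r !mulmxA => ->.
have := hN 0; rewrite mul0mx => e.
by rewrite [_ + c *m _ *m _]addrC -addrA -e addr0.
Qed.

Lemma image_form_sym : M' *m N'^T = N' *m M'^T.
Proof. by rewrite -translation_form MN -[LHS]trmxK trmx_mul trmxK
  translation_form trmx_mul trmxK. Qed.

(** If [c] kills [N'], then [hN] makes the linear form [v *m N^T *m c^T] constant in [v], hence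
    zero, so [c] kills [N]; it kills [M] because the kernels agree. *)
Lemma image_joint_inj (c : 'rV_n) : c *m M' = 0 -> c *m N' = 0 -> c = 0.
Proof.
move=> /translation_ker cM cN; apply: MN_inj => //.
have cN' : N'^T *m c^T = 0 by rewrite -trmx_mul cN trmx0.
have e v : v *m N^T *m c^T = s *m c^T.
  by rewrite hN mulmxDl -mulmxA cN' mulmx0 add0r.
apply: trmx_inj; rewrite trmx_mul trmx0; apply: eq_mulmx_rowvec => v.
by rewrite mulmxA e -(e 0) !mul0mx mulmx0.
Qed.

End NormalForm.

(* An isotropic pair (D | P) with D a coordinate projection: the complementary
   diagonal block of P is invertible. *)
Lemma isotropic_block_unit (F : fieldType) n (D P : 'M[F]_n) :
  D *m D = D -> D *m P^T = P *m D ->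
  (forall c : 'rV_n, c *m D = 0 -> c *m P = 0 -> c = 0) ->
  D + (1%:M - D) *m P *m (1%:M - D) \in unitmx.
Proof.
move=> DD DP inj; set E := 1%:M - D.
have ED : E *m D = 0 by rewrite mulmxBl mul1mx DD subrr.
have DE : D *m E = 0 by rewrite mulmxBr mulmx1 DD subrr.
(* Isotropy rewrites [P *m D] as [D *m P^T], which [E] kills. *)
have EPD : E *m P *m D = 0 by rewrite -mulmxA -DP mulmxA ED mul0mx.
rewrite -row_free_unit; apply: inj_row_free => c.
rewrite mulmxDr => e.
have cD : c *m D = 0.
  move/(congr1 (mulmx^~ D)): e; rewrite mulmxDl mul0mx -!mulmxA DD ED.
  by rewrite !mulmx0 addr0.
have cE : c *m E = c by rewrite mulmxBr cD mulmx1 subr0.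
apply: inj => //; move: e; rewrite cD add0r !mulmxA cE.
by rewrite /E mulmxBr mulmx1 -[in X in _ - X]cE -!mulmxA (mulmxA E) EPD mulmx0
  subr0.
Qed.

(** The rank factorization of [M] supplies a left factor [L] that serves for [M'] too. After
    removing [L], [U] and [U'] the two pairs become (D | P) and (D | P'); the invertible blocks [B]
    and [B'] then turn the preserved linear forms into coordinates. *)
Lemma normal_form (F : fieldType) n (h : 'rV[F]_n -> 'rV[F]_n)
    (M N M' N' : 'M[F]_n) (s : 'rV[F]_n) :
  injective h ->
  (forall v c, h (v + c *m M) = h v + c *m M') ->
  (forall v, v *m N^T = h v *m N'^T + s) ->
  M *m N^T = N *m M^T ->
  (forall c : 'rV_n, c *m M = 0 -> c *m N = 0 -> c = 0) ->
  exists (r : nat) (Q1 Q2 : 'M[F]_n) (q : 'rV[F]_n),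
    let D : 'M[F]_n := pid_mx r in
    let g u := h (u *m Q2) *m Q1 + q in
    [/\ Q1 \in unitmx, Q2 \in unitmx,
        forall u, g u *m (1%:M - D) = u *m (1%:M - D)
      & forall u c, g (u + c *m D) = g u + c *m D].
Proof.
move=> h_inj hM hN MN MN_inj.
have MN' := image_form_sym hM hN MN.
have MN_inj' := image_joint_inj h_inj hM hN MN_inj.
pose r := \rank M; pose L := col_ebase M; pose U := row_ebase M.
pose D : 'M[F]_n := pid_mx r.
have Lu : L \in unitmx := col_ebase_unit M.
have Uu : U \in unitmx := row_ebase_unit M.
have ML : M = L *m D *m U by rewrite mulmx_ebase.
have DD : D *m D = D by rewrite /D pid_mx_id // rank_leq_row.
have DT : D^T = D by rewrite tr_pid_mx.
(* [(1%:M - D) *m invmx L] kills [M], hence also [M']. *)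
have DM1 : D *m (invmx L *m M') = invmx L *m M'.
  apply/eqP; rewrite eq_sym -subr_eq0 -{1}[invmx L *m M']mul1mx -mulmxBl mulmxA.
  apply/eqP/(translation_ker_mx h_inj hM).
  by rewrite ML !mulmxA mulmxKV // mulmxBl mul1mx DD subrr mul0mx.
(* The first [r] rows of [invmx L *m M'] are independent since [M'] has rank [r]; they extend to a
   basis. *)
have [U' U'u DU'] : {U' | U' \in unitmx & D *m (invmx L *m M') = D *m U'}.
  apply: complete_unitmx; rewrite DM1.
  rewrite (eqmxMfull M') ?row_full_unit ?unitmx_inv //.
  by rewrite (translation_rank h_inj hM) rank_pid_mx ?rank_leq_row.
have M'L : M' = L *m D *m U' by rewrite -mulmxA -DU' DM1 mulKVmx.
pose P := invmx L *m N *m U^T; pose P' := invmx L *m N' *m U'^T.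
have red (X Y V : 'M[F]_n) : L *m D *m V = X -> X *m Y^T = Y *m X^T ->
    D *m (invmx L *m Y *m V^T)^T = (invmx L *m Y *m V^T) *m D.
  move=> <-; rewrite !trmx_mul !trmxK DT => e.
  have := congr1 (fun Z => invmx L *m Z *m (invmx L)^T) e.
  rewrite !mulmxA mulVmx // mul1mx => ->.
  by rewrite -[in X in X = _]mulmxA -trmx_mul mulVmx // trmx1 mulmx1.
have DP : D *m P^T = P *m D by exact: (red M N U (esym ML)).
have DP' : D *m P'^T = P' *m D by exact: (red M' N' U' (esym M'L)).
have inj0 (X Y V : 'M[F]_n) : L *m D *m V = X -> V \in unitmx ->
    (forall c : 'rV_n, c *m X = 0 -> c *m Y = 0 -> c = 0) ->
    forall c : 'rV_n, c *m D = 0 -> c *m (invmx L *m Y *m V^T) = 0 -> c = 0.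
  move=> <- Vu inj c cD cY.
  have : c *m invmx L = 0.
    apply: inj; first by rewrite !mulmxA mulmxKV // cD mul0mx.
    move/(congr1 (mulmx^~ (invmx V^T))): cY.
    by rewrite mul0mx !mulmxA mulmxK // unitmx_tr.
  by move/(congr1 (mulmx^~ L)); rewrite mulmxKV // mul0mx.
set E := 1%:M - D.
have ET : E^T = E by rewrite /E linearB /= trmx1 DT.
have ED : E *m D = 0 by rewrite mulmxBl mul1mx DD subrr.
have DE : D *m E = 0 by rewrite mulmxBr mulmx1 DD subrr.
have EE : E *m E = E by rewrite {1}/E mulmxBl mul1mx DE subr0.
pose B := D + E *m P *m E; pose B' := D + E *m P' *m E.
have Bu : B \in unitmx by apply: isotropic_block_unit => //;
  apply: (inj0 M N U (esym ML)).
have Bu' : B' \in unitmx by apply: isotropic_block_unit => //;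
  apply: (inj0 M' N' U' (esym M'L)).
have blockD Z : D *m (D + E *m Z *m E)^T = D.
  by rewrite [(D + _)^T]linearD /= DT mulmxDr DD !trmx_mul ET !mulmxA DE
    !mul0mx addr0.
have blockE Z : D *m Z^T = Z *m D -> (D + E *m Z *m E)^T *m E = Z^T *m E.
  move=> DZ; rewrite [(D + _)^T]linearD /= DT mulmxDl DE add0r !trmx_mul ET
    -!mulmxA EE.
  rewrite {1}/E mulmxBl mul1mx !mulmxA.
  (* This is the transpose of [E *m Z *m D = E *m D *m Z^T = 0]. *)
  have -> : D *m Z^T *m E = 0; last by rewrite subr0.
  have /(congr1 (mulmx E)) := DZ; rewrite !mulmxA ED mul0mx => e0.
  have /(congr1 trmx) := esym e0; rewrite !trmx_mul ET DT trmx0 mulmxA.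
  by move=> ->.
have BTu : B^T \in unitmx by rewrite unitmx_tr.
(* [D *m B^T = D] preserves the translations along [D], and [B^T *m E = P^T *m E] makes the forms
   the [E]-coordinates; likewise for [B']. The last witness absorbs the constant [s]. *)
exists r, (invmx U' *m B'^T), (invmx B^T *m U), (s *m (invmx L)^T *m E).
split.
- by rewrite unitmx_mul unitmx_inv U'u unitmx_tr.
- by rewrite unitmx_mul unitmx_inv BTu.
- move=> u; set w := u *m _.
  rewrite mulmxDl -[_ *m E *m E]mulmxA EE -!mulmxA blockE // /P' !trmx_mul
    trmxK !mulmxA.
  rewrite mulmxKV // -!mulmxDl -hN.
  have -> : w = u *m invmx B^T *m U by rewrite /w mulmxA.
  transitivity (u *m invmx B^T *m (P^T *m E)).
    by rewrite /P !trmx_mul trmxK !mulmxA.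
  by rewrite -(blockE P) // mulmxA mulmxKV.
move=> u c; set q := _ *m E.
have DB : D *m invmx B^T = D by rewrite -{1}(blockD P) mulmxK.
rewrite mulmxDl -[c *m D *m _]mulmxA (mulmxA D) DB.
(* In the old coordinates a translation along [D] is one by a combination of the rows of [M], so
   [hM] applies. *)
have -> : c *m (D *m U) = c *m invmx L *m M.
  by rewrite ML !mulmxA mulmxKV.
rewrite hM M'L mulmxDl addrAC; congr (_ + _).
by rewrite !mulmxA mulmxKV // mulmxK // -mulmxA blockD.
Qed.
(** * Degree of Boolean functions *)

Lemma F2_addrr (x : 'F_2) : x + x = 0.
Proof. by rewrite (addrr_pchar2 (pchar_Fp _)). Qed.

Lemma F2_cases (x : 'F_2) : x = 0 \/ x = 1.
Proof.
by case: x => [[|[|//]] lt]; [left|right]; apply/val_inj.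
Qed.

Lemma F2_mx_addrr m n (A : 'M['F_2]_(m, n)) : A + A = 0.
Proof. by apply/matrixP=> i j; rewrite !mxE F2_addrr. Qed.

Lemma F2_mx_opp m n (A : 'M['F_2]_(m, n)) : - A = A.
Proof. by apply/eqP; rewrite eq_sym -addr_eq0 F2_mx_addrr. Qed.

Lemma F2_mx_addrK m n (A B : 'M['F_2]_(m, n)) : A + B + B = A.
Proof. by rewrite -addrA F2_mx_addrr addr0. Qed.

Section Degree.
Variable n : nat.
Implicit Types (f g : 'rV['F_2]_n -> 'F_2) (v a : 'rV['F_2]_n).

Definition deriv2 a f v : 'F_2 := f (v + a) + f v.

(* [f] has algebraic normal form of degree at most [m]. *)
Fixpoint deg_le m f : Prop :=
  if m is m'.+1 then forall a, deg_le m' (deriv2 a f)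
  else forall v, f v = f 0.

Lemma eq_deg_le m f g : f =1 g -> deg_le m f -> deg_le m g.
Proof.
elim: m f g => [|m IH] f g fg /= df; first by move=> v; rewrite -!fg.
by move=> a; apply: IH (df a) => v; rewrite /deriv2 !fg.
Qed.

Lemma deg_le_const m (c : 'F_2) : deg_le m (fun=> c).
Proof.
elim: m c => [//|m IH] c /= a.
by apply: eq_deg_le (IH 0) => v; rewrite /deriv2 F2_addrr.
Qed.

Lemma deg_leS m f : deg_le m f -> deg_le m.+1 f.
Proof.
elim: m f => [|m IH] f df a; last exact/IH/df.
apply: (eq_deg_le (f := fun=> 0)) (deg_le_const 0 0) => v.
by rewrite /deriv2 !(df (_ + _)) (df v) F2_addrr.
Qed.

Lemma deg_leW m m' f : (m <= m')%N -> deg_le m f -> deg_le m' f.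
Proof.
by move=> /subnK <-; elim: (m' - m)%N => [//|d IH] /IH; apply: deg_leS.
Qed.

Lemma deg_leD m f g : deg_le m f -> deg_le m g ->
  deg_le m (fun v => f v + g v).
Proof.
elim: m f g => [|m IH] f g df dg /=; first by move=> v; rewrite df dg.
by move=> a; apply: eq_deg_le (IH _ _ (df a) (dg a)) => v;
  rewrite /deriv2 addrACA.
Qed.

Lemma deg_le_coord m (j : 'I_n) : (0 < m)%N -> deg_le m (fun v => v 0 j).
Proof.
move=> m0; apply: deg_leW m0 _ => a v.
by rewrite /deriv2 !mxE add0r addr0 addrAC F2_addrr add0r.
Qed.

Lemma deg_le_scale m (c : 'F_2) f : deg_le m f -> deg_le m (fun v => c * f v).
Proof.
case: (F2_cases c) => -> df.
  by apply: eq_deg_le (deg_le_const m 0) => v; rewrite mul0r.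
by apply: eq_deg_le df => v; rewrite mul1r.
Qed.

(** Leibniz rule: the derivative of $x_j f$ along $a$ is $x_j\,\partial_a f + a_j(\partial_a f +
    f)$. *)
Lemma deg_le_coordM m (j : 'I_n) f : deg_le m f ->
  deg_le m.+1 (fun v => v 0 j * f v).
Proof.
elim: m f => [|m IH] f df.
  apply: eq_deg_le (deg_le_scale (f 0) (deg_le_coord j (ltn0Sn 0))) => v.
  by rewrite df mulrC.
move=> a; have sf := deg_leD (deg_leS (df a)) df.
apply: eq_deg_le (deg_leD (IH _ (df a)) (deg_le_scale (a 0 j) sf)) => v.
rewrite /deriv2 -[f _ + _ + f v]addrA F2_addrr addr0 mxE mulrDr mulrDl.
by rewrite -!addrA; congr (_ + _); rewrite addrC.
Qed.

Lemma deg_le_monomial (S : {set 'I_n}) m : (#|S| <= m)%N ->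
  deg_le m (fun v => \prod_(i in S) v 0 i).
Proof.
move=> Sm; apply: deg_leW Sm _; rewrite cardE.
apply: (eq_deg_le (f := fun v => \prod_(i <- enum S) v 0 i)).
  by move=> v; rewrite big_enum.
elim: (enum S) => [|i s IH].
  by apply: (eq_deg_le (m := 0%N) (f := fun=> 1)) => // v; rewrite big_nil.
apply: (eq_deg_le (m := (size s).+1) (f := fun v => v 0 i * \prod_(i <- s) v 0
  i)).
  by move=> v; rewrite big_cons.
exact: deg_le_coordM.
Qed.

Definition indep f (j : 'I_n) := forall v, f (v + delta_mx 0 j) = f v.

(** Every [v] is reached from 0 by adding basis vectors one at a time. *)
Lemma indep_all f : (forall j, indep f j) -> forall v, f v = f 0.
Proof.
move=> fj v; rewrite (row_sum_delta v) -[LHS]/(f _).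
elim: (index_enum _) => [|j s IH]; first by rewrite big_nil.
rewrite big_cons; case: (F2_cases (v 0 j)) => ->.
  by rewrite scale0r add0r.
by rewrite scale1r addrC fj.
Qed.

(* Induction on the variables, splitting
   f = f(x_j := 0) + x_j * deriv2 e_j f. *)
Lemma anf_exists (l : seq 'I_n) m f : uniq l -> deg_le m f ->
  (forall j, j \notin l -> indep f j) ->
  exists Ss : seq {set 'I_n},
    (forall S, S \in Ss -> {subset S <= l} /\ (#|S| <= m)%N) /\
    forall v, f v = \sum_(S <- Ss) \prod_(i in S) v 0 i.
Proof.
elim: l m f => [|j l IH] m f.
  move=> _ _ fl; have fc := indep_all (fun j => fl j isT);
    case: (F2_cases (f 0)) => f0.
    by exists [::]; split=> // v; rewrite big_nil fc f0.
  exists [:: set0]; split=> [S|v].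
    by rewrite inE => /eqP ->; rewrite cards0; split=> // i; rewrite inE.
  by rewrite big_seq1 big_set0 fc f0.
move=> /= /andP[jl ul] df fl; pose f1 := deriv2 (delta_mx 0 j) f.
case: m df => [|m] df.
  have [|Ss [SsP Ssf]] := IH 0%N f ul df.
    by move=> i il v; rewrite [LHS]df [RHS]df.
  exists Ss; split=> // S /SsP[Sl Sm]; split=> // i /Sl il.
  by rewrite inE il orbT.
have f1j : indep f1 j by move=> v; rewrite /f1 /deriv2 F2_mx_addrK addrC.
have f1i i : i \notin j :: l -> indep f1 i.
  by move=> il v; rewrite /f1 /deriv2 addrAC !(fl i il).
have f1l i : i \notin l -> indep f1 i.
  by case: (eqVneq i j) => [-> //|ij il]; apply: f1i; rewrite inE negb_or ij.
have [Ss1 [Ss1P Ss1f]] := IH m f1 ul (df _) f1l.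
(* In characteristic 2 this is [f] with the variable [j] set to 0. *)
pose f0 v := f v + v 0 j * f1 v.
have df0 : deg_le m.+1 f0 by apply/deg_leD/deg_le_coordM/df.
have f0l i : i \notin l -> indep f0 i.
  move=> il v; rewrite /f0 (f1l i il) mxE mxE eqxx /= [j == i]eq_sym.
  case: (eqVneq i j) => [->|ij].
    rewrite mulrDl mul1r /f1 /deriv2 [v 0 j * _ + _]addrC addrA addrA.
    by rewrite F2_addrr add0r.
  by rewrite addr0 (fl i) // inE negb_or ij.
have [Ss0 [Ss0P Ss0f]] := IH m.+1 f0 ul df0 f0l.
(* The monomials of [f0], then those of [f1] multiplied by the variable [j]. *)
exists (Ss0 ++ [seq j |: S1 | S1 : {set _} <- Ss1]); split=> [S|v].
  rewrite mem_cat => /orP[/Ss0P[Sl Sm]|/mapP[S1 /Ss1P[Sl Sm] ->]].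
    by split=> // i /Sl il; rewrite inE il orbT.
  split=> [i|]; first by rewrite !inE => /orP[->//|/Sl ->]; rewrite orbT.
  by rewrite (leq_trans (leq_card_setU _ _)) // cards1 add1n.
rewrite big_cat big_map /= -Ss0f.
have -> : \sum_(S <- Ss1) \prod_(i in j |: S) v 0 i = v 0 j * f1 v.
  rewrite Ss1f mulr_sumr big_seq [RHS]big_seq; apply: eq_bigr => S /Ss1P[Sl _].
  by rewrite big_setU1 //=; apply: contra jl => /Sl.
by rewrite /f0 -addrA F2_addrr addr0.
Qed.

(** * The bilinear form on $\mathbb{F}_2^n$ and affine functions *)

Definition dot (b w : 'rV['F_2]_n) : 'F_2 := (b *m w^T) 0 0.

Lemma dotDl b b' w : dot (b + b') w = dot b w + dot b' w.
Proof. by rewrite /dot mulmxDl mxE. Qed.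
Lemma dotDr b w w' : dot b (w + w') = dot b w + dot b w'.
Proof. by rewrite /dot linearD mulmxDr mxE. Qed.
Lemma dot0l w : dot 0 w = 0.
Proof. by rewrite /dot mul0mx mxE. Qed.
Lemma dot0r w : dot w 0 = 0.
Proof. by rewrite /dot trmx0 mulmx0 mxE. Qed.
Lemma dotC b w : dot b w = dot w b.
Proof. by rewrite /dot -[in RHS](trmxK w) -trmx_mul [RHS]mxE. Qed.
Lemma dot_mulmxl b (A : 'M_n) w : dot (b *m A) w = dot b (w *m A^T).
Proof. by rewrite /dot trmx_mul trmxK mulmxA. Qed.
Lemma dot_sum b w : dot b w = \sum_j b 0 j * w 0 j.
Proof. by rewrite /dot mxE; apply: eq_bigr => j _; rewrite !mxE. Qed.
Lemma dot_delta b (j : 'I_n) : dot b (delta_mx 0 j) = b 0 j.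
Proof.
rewrite dot_sum (bigD1 j) //= big1 ?addr0 => [|i ij];
  rewrite !mxE ?eqxx ?mulr1 //.
by rewrite (negPf ij) mulr0.
Qed.
Lemma dot_deltal (j : 'I_n) b : dot (delta_mx 0 j) b = b 0 j.
Proof. by rewrite dotC dot_delta. Qed.

Lemma deg_le1_affine f : deg_le 1 f ->
  exists b, forall v, f v = f 0 + dot b v.
Proof.
move=> df; exists (\row_j (f (delta_mx 0 j) + f 0)) => v.
(* A constant derivative along each [a] makes [f + f 0] additive, so its values on basis vectors
   determine it. *)
have fD w a : f (w + a) + f 0 = (f w + f 0) + (f a + f 0).
  have := df a w; rewrite /deriv2 add0r => e.
  by rewrite -e [RHS]addrC -addrA [f w + (_ + _)]addrA F2_addrr add0r.
suff -> : dot (\row_j (f (delta_mx 0 j) + f 0)) v = f v + f 0.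
  by rewrite addrC -addrA F2_addrr addr0.
rewrite dot_sum {2}(row_sum_delta v).
elim: (index_enum _) => [|j s IH]; first by rewrite !big_nil F2_addrr.
rewrite !big_cons fD -IH mxE; congr (_ + _).
by case: (F2_cases (v 0 j)) => ->;
  rewrite ?scale0r ?mulr0 ?F2_addrr // scale1r mulr1.
Qed.

End Degree.
(** * Monomial operators and the Pauli group *)

Section Monomial.
Variables (C : numClosedFieldType) (n : nat).
Local Notation V := 'rV['F_2]_n.
Implicit Types (f : V -> V -> C) (h : V -> V) (th : V -> C) (v w a b : V).

Lemma eq_op_of f f' : f =2 f' -> op_of f = op_of f'.
Proof. by move=> ff; apply/matrixP=> i j; rewrite !mxE ff. Qed.

Lemma op_of_inj f f' : op_of f = op_of f' -> f =2 f'.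
Proof.
move=> /matrixP e v w; have := e (enum_rank v) (enum_rank w).
by rewrite !mxE !enum_rankK.
Qed.

Lemma op_ofP (U : op C n) :
  U = op_of (fun v w => U (enum_rank v) (enum_rank w)).
Proof. by apply/matrixP=> i j; rewrite mxE !enum_valK. Qed.

Lemma mul_op_of f f' :
  op_of f *m op_of f' = op_of (fun v w => \sum_u f v u * f' u w).
Proof.
apply/matrixP=> i j; rewrite !mxE (reindex (@enum_rank (bits n))) /=.
  by apply: eq_bigr => u _; rewrite !mxE enum_rankK.
exact/onW_bij/enum_rank_bij.
Qed.

Lemma adj_op_of f : (op_of f)^t* = op_of (fun v w => (f w v)^*).
Proof. by apply/matrixP=> i j; rewrite !mxE. Qed.

Lemma op_of1 : 1%:M = op_of (fun v w => (v == w)%:R) :> op C n.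
Proof. by apply/matrixP=> i j; rewrite !mxE (inj_eq enum_val_inj). Qed.

(** The monomial operator $|w\rangle \mapsto th(w)\,|h(w)\rangle$: Pauli operators, diagonal sign
    gates and permutation gates all have this form. *)
Definition mono h th : op C n := op_of (fun v w => th w * (v == h w)%:R).

Lemma eq_mono h h' th th' : h =1 h' -> th =1 th' -> mono h th = mono h' th'.
Proof. by move=> hh tt; apply: eq_op_of => v w; rewrite hh tt. Qed.

Lemma monomial_inj h h' th th' : mono h th = mono h' th' ->
  (forall w, th w != 0) -> h =1 h' /\ th =1 th'.
Proof.
move=> /op_of_inj e th0.
have hh : h =1 h'.
  move=> w; have := e (h w) w; rewrite eqxx mulr1.
  by case: eqP => // _ /eqP; rewrite mulr0 (negPf (th0 w)).
by split=> // w; have := e (h w) w; rewrite -(hh w) !eqxx !mulr1.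
Qed.

Lemma op_of_mono f h th :
  op_of f *m mono h th = op_of (fun v w => f v (h w) * th w).
Proof.
rewrite mul_op_of; apply: eq_op_of => v w.
rewrite (bigD1 (h w)) //= eqxx mulr1 big1 ?addr0 // => u /negPf ->.
by rewrite !mulr0.
Qed.

Lemma mono_op_of h g th f : cancel g h -> cancel h g ->
  mono h th *m op_of f = op_of (fun v w => th (g v) * f (g v) w).
Proof.
move=> gh hg; rewrite mul_op_of; apply: eq_op_of => v w.
rewrite (bigD1 (g v)) //= gh eqxx mulr1 big1 ?addr0 // => u ug.
by rewrite (negPf (_ : v != h u)) ?mulr0 ?mul0r //;
  apply: contra ug => /eqP ->; rewrite hg.
Qed.

Lemma mono_mul h h' th th' :
  mono h th *m mono h' th' = mono (h \o h') (fun w => th (h' w) * th' w).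
Proof.
rewrite op_of_mono; apply: eq_op_of => v w /=.
by rewrite -mulrA [_%:R * _]mulrC mulrA.
Qed.

Lemma mono1 : mono id (fun=> 1) = 1%:M.
Proof. by rewrite op_of1; apply: eq_op_of => v w; rewrite mul1r. Qed.

Lemma mono_adj h g th : cancel g h -> cancel h g ->
  (mono h th)^t* = mono g (fun v => (th (g v))^*).
Proof.
move=> gh hg; rewrite adj_op_of; apply: eq_op_of => v w.
rewrite rmorphM /= rmorph_nat; case: (eqVneq w (h v)) => [->|wh].
  by rewrite hg eqxx.
by rewrite (negPf (_ : v != g w)) ?mulr0 //; apply: contra wh => /eqP ->;
  rewrite gh.
Qed.

Lemma mono_gate h g th : cancel g h -> cancel h g ->
  (forall w, th w * (th w)^* = 1) -> is_gate (mono h th).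
Proof.
move=> gh hg t1; apply/unitarymxP; rewrite (mono_adj _ gh hg) mono_mul -mono1.
by apply: eq_mono => v /=.
Qed.

Definition sg (x : 'F_2) : C := (-1) ^+ x.

Lemma sg0 : sg 0 = 1. Proof. by []. Qed.
Lemma sg1 : sg 1 = -1. Proof. by []. Qed.

Lemma sgD x y : sg (x + y) = sg x * sg y.
Proof.
by case: (F2_cases x) => ->; case: (F2_cases y) => ->;
  rewrite ?add0r ?addr0 ?F2_addrr ?sg0 ?sg1 ?mulr1 ?mul1r ?mulrNN ?mulr1.
Qed.

Lemma sg_sum (I : Type) (r : seq I) (F : I -> 'F_2) :
  \prod_(i <- r) sg (F i) = sg (\sum_(i <- r) F i).
Proof. by rewrite (big_morph _ sgD sg0). Qed.

Lemma sgK x : sg x * sg x = 1.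
Proof. by rewrite -sgD F2_addrr. Qed.

Lemma sg_conj x : (sg x)^* = sg x.
Proof. by rewrite /sg rmorphXn rmorphN1. Qed.

Lemma sg_neq0 x : sg x != 0.
Proof. by rewrite signr_eq0. Qed.

Lemma sg_inj : injective sg.
Proof.
move=> x y; case: (F2_cases x) => ->; case: (F2_cases y) => -> //;
  rewrite sg0 sg1.
  by move/eqP; rewrite -addr_eq0 -[1 + 1]/(2%:R) pnatr_eq0.
by move/eqP; rewrite eq_sym -addr_eq0 -[1 + 1]/(2%:R) pnatr_eq0.
Qed.

Lemma sg4 x : sg x ^+ 4 = 1.
Proof. by rewrite (exprM _ 2 2) [sg x ^+ 2]expr2 sgK expr1n. Qed.

(** This is $c X^a Z^b$, with [Z] acting first. *)
Definition pauli (c : C) a b : op C n :=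
  mono (+%R^~ a) (fun w => c * sg (dot b w)).

Lemma phase4P (c : C) : c \in [:: 1; -1; 'i; - 'i] <-> c ^+ 4 = 1.
Proof.
rewrite !inE; split.
  have i4 : 'i ^+ 4 = 1 :> C by rewrite (exprM _ 2 2) sqrCi sqrrN expr1n.
  by case/or4P=> /eqP ->;
    rewrite ?i4 ?expr1n // (exprM _ 2 2) sqrrN -exprM ?i4 ?expr1n.
move=> c4; have : (c - 1) * (c + 1) * ((c - 'i) * (c + 'i)) = 0.
  rewrite -!subr_sqr sqrCi expr1n;
    have -> : (c ^+ 2 - 1) * (c ^+ 2 - -1) = c ^+ 4 - 1 by ring.
  by rewrite c4 subrr.
move/eqP; rewrite !mulf_eq0 !subr_eq0 !addr_eq0 => /orP[/orP[]|/orP[]] -> //;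
by rewrite ?orbT.
Qed.

Lemma phase4_conj (c : C) : c ^+ 4 = 1 -> c^* ^+ 4 = 1.
Proof. by move=> c4; rewrite -rmorphXn c4 rmorph1. Qed.

Lemma phase4_norm (c : C) : c ^+ 4 = 1 -> c * c^* = 1.
Proof.
move=> c4; rewrite -normCK; have /eqP := congr1 (fun x => `|x|) c4.
by rewrite normrX normr1 pexprn_eq1 // => /eqP ->; rewrite expr1n.
Qed.

Lemma phase4_neq0 (c : C) : c ^+ 4 = 1 -> c != 0.
Proof. by move=> c4; apply: contra_eq_neq c4 => ->;
  rewrite expr0n /= eq_sym oner_eq0. Qed.

Definition pauli1 (c : C) (x z : 'F_2) : 'M[C]_2 :=
  \matrix_(i < 2, j < 2)
    (c * sg (z * (j : 'F_2)) * ((i : 'F_2) == (j : 'F_2) + x)%:R).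

Lemma pauli1E c x z (i j : 'F_2) :
  pauli1 c x z i j = c * sg (z * j) * (i == j + x)%:R.
Proof. by rewrite mxE. Qed.

Lemma matrix2P (A B : 'M[C]_2) : (forall i j : 'F_2, A i j = B i j) -> A = B.
Proof. by move=> AB; apply/matrixP=> i j; apply: AB. Qed.

Lemma pauli1_I : pauli1 1 0 0 = 1%:M.
Proof.
by apply: matrix2P => i j; rewrite !mxE mul0r sg0 !mul1r addr0.
Qed.

Lemma pauli1_X : pauli1 1 1 0 = pauliX C.
Proof.
apply: matrix2P => i j; rewrite !mxE mul0r sg0 !mul1r; congr (_%:R).
by case: (F2_cases i) => ->; case: (F2_cases j) => ->.
Qed.

Lemma pauli1_Z : pauli1 1 0 1 = pauliZ C.
Proof.
apply: matrix2P => i j; rewrite !mxE mul1r mul1r addr0.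
by case: eqVneq => [->|]; rewrite ?mulr1 ?mulr0.
Qed.

Lemma pauli1_Y : pauli1 'i 1 1 = pauliY C.
Proof.
apply: matrix2P => i j; rewrite !mxE mul1r.
by case: (F2_cases i) => ->; case: (F2_cases j) => ->;
   rewrite ?sg0 ?sg1 /= ?mulr1 ?mulr0 ?mulrN1.
Qed.

Lemma tensor_pauli1 (c : 'I_n -> C) (x z : 'I_n -> 'F_2) :
  tensor (fun j => pauli1 (c j) (x j) (z j)) =
  pauli (\prod_j c j) (\row_j x j) (\row_j z j).
Proof.
apply: eq_op_of => v w.
rewrite (eq_bigr _ (fun j _ => pauli1E _ _ _ _ _)) !big_split /= sg_sum;
  congr (_ * _ * _).
  by congr sg; rewrite dot_sum; apply: eq_bigr => j _; rewrite mxE.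
case: eqVneq => [->|vw].
  by rewrite big1 // => j _; rewrite !mxE eqxx.
(* If [v] differs from the shifted [w] at one coordinate, that factor of the tensor product
   vanishes. *)
have [j vj] : exists j, v 0 j != w 0 j + x j.
  apply/existsP; rewrite -negb_forall; apply: contra vw => /forallP vw.
  by apply/eqP/rowP=> j; rewrite !mxE; apply/eqP.
by rewrite (bigD1 j) //= (negPf vj) mul0r.
Qed.

Lemma scale_pauli c c' a b : c *: pauli c' a b = pauli (c * c') a b.
Proof. by apply/matrixP=> i j; rewrite !mxE !mulrA. Qed.

Lemma is_pauliP (U : op C n) :
  is_pauli U <-> exists c a b, c ^+ 4 = 1 /\ U = pauli c a b.
Proof.
split=> [[c [P [/phase4P c4 Pj ->]]]|[c [a [b [c4 ->]]]]].
  have [t tP] : exists t : 'I_n -> C * 'F_2 * 'F_2, forall j,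
      (t j).1.1 ^+ 4 = 1 /\ P j = pauli1 (t j).1.1 (t j).1.2 (t j).2.
    apply: (fin_all_exists (P := fun j (t : C * 'F_2 * 'F_2) =>
      t.1.1 ^+ 4 = 1 /\ P j = pauli1 t.1.1 t.1.2 t.2)) => j.
    have := Pj j; rewrite !inE => /or4P[] /eqP ->.
    - by exists (1, 0, 0); rewrite pauli1_I expr1n.
    - by exists (1, 1, 0); rewrite pauli1_X expr1n.
    - by exists ('i, 1, 1); rewrite pauli1_Y; split=> //; apply/phase4P;
      rewrite !inE eqxx !orbT.
    - by exists (1, 0, 1); rewrite pauli1_Z expr1n.
  exists (c * \prod_j (t j).1.1), (\row_j (t j).1.2), (\row_j (t j).2); split.
    by rewrite exprMn c4 mul1r -prodrXl big1 // => j _; case: (tP j).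
  rewrite -scale_pauli -tensor_pauli1; congr (_ *: _).
  by apply: eq_op_of => v w; apply: eq_bigr => j _; rewrite (tP j).2.
(* Since $Y = iXZ$, each qubit carrying both [X] and [Z] contributes a factor $i$, which the scalar
   in front must compensate. *)
pose g j : C := if (a 0 j == 1) && (b 0 j == 1) then 'i else 1.
have i4 : 'i ^+ 4 = 1 :> C by apply/phase4P; rewrite !inE eqxx !orbT.
have g4 : (\prod_j g j) ^+ 4 = 1.
  by rewrite -prodrXl big1 // => j _; rewrite /g; case: ifP; rewrite ?expr1n.
exists (c * (\prod_j g j)^-1), (fun j => pauli1 (g j) (a 0 j) (b 0 j)); split.
- by apply/phase4P; rewrite exprMn c4 exprVn g4 invr1 mulr1.
- move=> j; rewrite /g !inE.
  case: (F2_cases (a 0 j)) => ->; case: (F2_cases (b 0 j)) => -> /=;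
  by rewrite ?pauli1_I ?pauli1_X ?pauli1_Y ?pauli1_Z ?eqxx ?orbT.
rewrite tensor_pauli1 scale_pauli -mulrA mulVf ?phase4_neq0 // mulr1.
by congr pauli; apply/rowP=> j; rewrite mxE.
Qed.

Lemma pauliM c c' a a' b b' :
  pauli c a b *m pauli c' a' b' =
  pauli (c * c' * sg (dot b a')) (a + a') (b + b').
Proof.
rewrite mono_mul; apply: eq_mono => w /=; first by rewrite addrA addrAC.
by rewrite dotDl dotDr !sgD; ring.
Qed.

Lemma pauli_adj c a b : (pauli c a b)^t* = pauli (c^* * sg (dot b a)) a b.
Proof.
have aK : cancel (+%R^~ a) (+%R^~ a) by move=> v; apply: F2_mx_addrK.
rewrite (mono_adj _ aK aK); apply: eq_mono => // w.
by rewrite rmorphM /= sg_conj dotDr sgD; ring.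
Qed.

Lemma pauli_gate c a b : c ^+ 4 = 1 -> is_gate (pauli c a b).
Proof.
move=> c4; apply: (@mono_gate _ (+%R^~ a)) => [v|v|w]; rewrite ?F2_mx_addrK //.
by rewrite rmorphM /= sg_conj mulrACA sgK mulr1 phase4_norm.
Qed.

(** The commutation sign is given by the symplectic form of the exponent vectors. *)
Lemma pauliC c c' a a' b b' :
  pauli c a b *m pauli c' a' b' =
  sg (dot b a' + dot a b') *: (pauli c' a' b' *m pauli c a b).
Proof.
rewrite !pauliM scale_pauli sgD [dot a b']dotC [a' + a]addrC [b' + b]addrC.
by congr pauli; have := sgK (dot b' a) => e;
  rewrite -{1}[sg (dot b a')]mulr1 -e; ring.
Qed.

Lemma pauli_neq0 c a b : c ^+ 4 = 1 -> pauli c a b != 0.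
Proof.
move=> c4; apply/eqP=> /matrixP /(_ (enum_rank a) (enum_rank (0 : V))).
rewrite !mxE !enum_rankK add0r eqxx mulr1 => /eqP.
by rewrite mulf_eq0 (negPf (phase4_neq0 c4)) (negPf (sg_neq0 _)).
Qed.

End Monomial.
(** * The Clifford hierarchy *)

Section Clifford.
Variables (C : numClosedFieldType) (n : nat).
Local Notation V := 'rV['F_2]_n.
Local Notation op := (op C n).
Implicit Types (U P W : op) (h : V -> V) (a b v w : V).

Lemma pauli_inj c c' a a' b b' : c != 0 -> pauli c a b = pauli c' a' b' :> op ->
  [/\ c = c', a = a' & b = b'].
Proof.
move=> c0 /monomial_inj[w|ha hb]; first by rewrite mulf_neq0 ?sg_neq0.
have cc : c = c' by have := hb 0; rewrite !dot0r sg0 !mulr1.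
split=> //; first by have := ha 0; rewrite !add0r.
apply/rowP=> j; have := hb (delta_mx 0 j); rewrite -cc !dot_delta.
by move/(mulfI c0)/sg_inj.
Qed.

Lemma gate_mulK U W : is_gate U -> W *m U *m U^t* = W.
Proof. exact: mulmxtVK. Qed.

Lemma gate_mulVK U W : is_gate U -> W *m U^t* *m U = W.
Proof. by move=> Ug; apply: mulmxKtV. Qed.

Lemma gate_adj U : is_gate U -> is_gate (U^t*).
Proof. by rewrite /is_gate trmxC_unitary. Qed.

Lemma gate_mulKV U : is_gate U -> U^t* *m U = 1%:M.
Proof. by move=> /(gate_mulVK 1%:M); rewrite mul1mx. Qed.

Lemma adj_mul U W : (U *m W)^t* = W^t* *m U^t*.
Proof. by rewrite trmx_mul map_mxM. Qed.

(* Conjugation by [U] is an injection of the finite Pauli group into itself. *)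
Lemma clifford_adj U : is_clifford U -> is_clifford (U^t*).
Proof.
move=> [Ug UP]; split=> [|P0 P0p]; first exact: gate_adj.
(* A finite index set for the Pauli group: phase, [X]-exponent, [Z]-exponent. *)
rewrite trmxCK; pose Q := (seq_sub [:: 1; -1; 'i; - 'i : C] * V * V)%type.
pose F (q : Q) : op := pauli (ssval q.1.1) q.1.2 q.2.
have c4 (q : Q) : ssval q.1.1 ^+ 4 = 1 by apply/phase4P/ssvalP.
have FP q : is_pauli (F q) by apply/is_pauliP; exists (ssval q.1.1), q.1.2, q.2.
have PF P : is_pauli P -> exists q, P = F q.
  by move=> /is_pauliP[c [a [b [/phase4P cl ->]]]]; exists (SeqSub cl, a, b).
have Finj : injective F.
  move=> [[c a] b] [[c' a'] b'] /(pauli_inj (phase4_neq0 (c4 (c, a, b))))[/= cc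
    -> ->].
  by congr (_, _, _); apply: val_inj.
have [k kP] : exists k : Q -> Q, forall q, U *m F q *m U^t* = F (k q).
  apply: (fin_all_exists (P := fun q q' => U *m F q *m U^t* = F q')) => q.
  exact/PF/UP/FP.
have kinj : injective k.
  move=> q q' kk; apply: Finj.
  have := congr1 F kk; rewrite -!kP => /(congr1 (fun X => U^t* *m X *m U)).
  by rewrite !mulmxA !gate_mulVK // gate_mulKV // !mul1mx.
(* An injective self-map of a finite set is onto, so [P0] is itself the conjugate by [U] of some
   Pauli operator. *)
have [k' _ k'K] := injF_bij kinj.
have [q ->] := PF _ P0p.
by rewrite -(k'K q) -kP !mulmxA gate_mulVK // gate_mulKV // mul1mx; apply: FP.
Qed.

Lemma level_gate m U : clifford_level m U -> is_gate U.
Proof.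
case: m => [//|[|m]] /=; last by case.
by move=> /is_pauliP[c [a [b [c4 ->]]]]; apply: pauli_gate.
Qed.

Lemma level_pauli_conj m U P : clifford_level m.+2 U -> is_pauli P ->
  clifford_level m.+1 (U *m P *m U^t*).
Proof. by move=> Ul Pp; apply: Ul.2. Qed.

(** Induction on the level: conjugating $P$ by $UWU^\dagger$ amounts to conjugating the Pauli
    operator $U^\dagger P U$ by $W$, then the result by $U$. *)
Lemma level_conj m U W : is_clifford U -> clifford_level m W ->
  clifford_level m (U *m W *m U^t*).
Proof.
move=> Uc; have Ug := level_gate (m := 2) Uc.
elim: m W => [//|[|m] IH] W; first by move=> Wp; apply: Uc.2.
move=> Wl; have Wg := level_gate Wl; split=> [|P Pp].
  by rewrite /is_gate !mul_unitarymx ?gate_adj.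
have := IH _ (Wl.2 _ ((clifford_adj Uc).2 _ Pp)).
by rewrite !adj_mul !trmxCK !mulmxA.
Qed.

(** The level starts at 2, because $\mathcal{C}_1$ is not stable under multiplication by Clifford
    gates. *)
Lemma level_mulr m U W : is_clifford W -> clifford_level m.+2 U ->
  clifford_level m.+2 (U *m W).
Proof.
move=> Wc Ul; have Ug := level_gate Ul; split=> [|P Pp].
  by rewrite /is_gate mul_unitarymx // (level_gate (m := 2) Wc).
by have := level_pauli_conj Ul (Wc.2 _ Pp); rewrite adj_mul !mulmxA.
Qed.

Lemma level_mull m U W : is_clifford U -> clifford_level m.+2 W ->
  clifford_level m.+2 (U *m W).
Proof.
move=> Uc Wl; have Wg := level_gate Wl; split=> [|P Pp].
  by rewrite /is_gate mul_unitarymx // (level_gate (m := 2) Uc).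
by have := level_conj Uc (level_pauli_conj Wl Pp); rewrite adj_mul !mulmxA.
Qed.

Lemma cliffordM U W : is_clifford U -> is_clifford W -> is_clifford (U *m W).
Proof. exact: (@level_mull 0). Qed.

(** A criterion without adjoints, and only for Pauli operators of phase 1. *)
Lemma clifford_intertwine U : is_gate U ->
  (forall a b, exists c a' b', c ^+ 4 = 1 /\
    U *m pauli 1 a b = pauli c a' b' *m U) ->
  is_clifford U.
Proof.
move=> Ug UP; split=> // P /is_pauliP[c [a [b [c4 ->]]]].
have [c' [a' [b' [c'4 e]]]] := UP a b.
apply/is_pauliP; exists (c * c'), a', b'; split;
  first by rewrite exprMn c4 c'4 mulr1.
by rewrite -[c]mulr1 -scale_pauli -scalemxAr e -scalemxAl gate_mulK //
  scale_pauli mulr1.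
Qed.

Lemma pauli_clifford P : is_pauli P -> is_clifford P.
Proof.
move=> /is_pauliP[c [a [b [c4 ->]]]].
apply: clifford_intertwine => [|a' b']; first exact: pauli_gate.
exists (sg C (dot b a' + dot a b')), a', b'; rewrite sg4; split=> //.
by rewrite pauliC scalemxAl scale_pauli mulr1.
Qed.

Lemma level_pauli_mull m U P : is_pauli P -> clifford_level m U ->
  clifford_level m (P *m U).
Proof.
case: m => [//|[|m]] Pp; last by apply/level_mull/pauli_clifford.
move: Pp => /is_pauliP[c [a [b [c4 ->]]]] /is_pauliP[c' [a' [b' [c'4 ->]]]].
apply/is_pauliP; rewrite pauliM; eexists _, _, _; split; last by [].
by rewrite !exprMn c4 c'4 sg4 !mulr1.
Qed.

Lemma pauli_adj_pauli P : is_pauli P -> is_pauli (P^t*).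
Proof.
move=> /is_pauliP[c [a [b [c4 ->]]]]; apply/is_pauliP; rewrite pauli_adj.
by eexists _, _, _; split; last by []; rewrite exprMn phase4_conj // sg4 mulr1.
Qed.

(** * Diagonal sign gates *)

Definition diag_sign (g : V -> 'F_2) : op := mono id (fun v => sg C (g v)).

Lemma diag_sign_gate g : is_gate (diag_sign g).
Proof. by apply: (@mono_gate _ _ id id) => // w; rewrite sg_conj sgK. Qed.

Lemma diag_sign_diag g : is_diag_gate (diag_sign g).
Proof.
split; first exact: diag_sign_gate.
apply/is_diag_mxP=> i j ij; rewrite mxE.
by rewrite (negPf (_ : _ != _)) ?mulr0 // (inj_eq enum_val_inj).
Qed.

(** The [Z] part commutes with the diagonal gate; moving past $X^a$ shifts the argument of [g] by
    [a]. *)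
Lemma diag_sign_conj g c a b :
  diag_sign g *m pauli c a b *m (diag_sign g)^t* =
  pauli c a b *m diag_sign (deriv2 a g).
Proof.
rewrite (@mono_adj _ _ id id) // !mono_mul; apply: eq_mono => // v /=.
by rewrite sg_conj /deriv2 sgD; ring.
Qed.

Lemma diag_sign_level m g : clifford_level m.+1 (diag_sign g) <-> deg_le m.+1 g.
Proof.
elim: m g => [|m IH] g.
  (* Level 1: a diagonal Pauli operator has signs $c(-1)^{b\cdot v}$, so [g] is affine. *)
  split=> [/is_pauliP[c [a [b [c4 /monomial_inj e0]]]] x v|].
    have [w|_ e] := e0; first exact: sg_neq0.
    have gb w : g w = g 0 + dot b w.
      by apply: (@sg_inj C); rewrite sgD !e dot0r sg0 mulr1.
    rewrite /deriv2 add0r (gb (v + x)) (gb v) (gb x) dotDr addrACA [RHS]addrAC.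
    by congr (_ + _); rewrite addrAC F2_addrr add0r.
  move=> /deg_le1_affine[b gb]; apply/is_pauliP.
  exists (sg C (g 0)), 0, b; rewrite sg4; split=> //.
  by apply: eq_mono => v; rewrite ?addr0 // gb sgD.
split=> [Dl a|dg].
  have Xp : is_pauli (pauli (1 : C) a 0) by apply/is_pauliP; exists 1, a, 0;
    rewrite expr1n.
  (* Multiplying the conjugate of $X^a$ by its adjoint leaves exactly the diagonal gate of the
     derivative of [g] along [a]. *)
  have := level_pauli_mull (pauli_adj_pauli Xp) (level_pauli_conj Dl Xp).
  rewrite diag_sign_conj mulmxA gate_mulKV ?mul1mx;
    last exact: (level_gate (m := 1)).
  by move=> /IH.
split=> [|P Pp]; first exact: diag_sign_gate.
have := Pp => /is_pauliP[c [a [b [c4 Pe]]]].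
by rewrite Pe diag_sign_conj -Pe; apply/level_pauli_mull/IH => //; apply: dg.
Qed.

(** * Permutation gates *)

Definition perm_op h : op := mono h (fun=> 1).

Lemma perm_opM h h' : perm_op h *m perm_op h' = perm_op (h \o h').
Proof. by rewrite mono_mul; apply: eq_mono => // v; rewrite mulr1. Qed.

Lemma eq_perm_op h h' : h =1 h' -> perm_op h = perm_op h'.
Proof. by move=> hh; apply: eq_mono. Qed.

Lemma perm_op_adj h g : cancel g h -> cancel h g -> (perm_op h)^t* = perm_op g.
Proof. by move=> gh hg; rewrite (mono_adj _ gh hg); apply: eq_mono => // v;
  rewrite rmorph1. Qed.

Lemma perm_op_gate h g : cancel g h -> cancel h g -> is_gate (perm_op h).
Proof. by move=> gh hg; apply: (mono_gate gh hg) => w;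
  rewrite rmorph1 mulr1. Qed.

Lemma is_perm_gateP U :
  is_perm_gate U <-> exists h, injective h /\ U = perm_op h.
Proof.
split=> [[Ug /is_perm_mxP[s ->]]|[h [hinj ->]]].
  (* The ones of [perm_mx s] are at the entries [(i, s i)], so columns are sent to rows by the
     inverse of [s]. *)
  exists (fun w => enum_val ((s^-1)%g (enum_rank w))); split.
    by move=> v w /enum_val_inj/perm_inj/enum_rank_inj.
  apply/matrixP=> i j; rewrite !mxE mul1r enum_valK (inj_eq enum_val_inj).
  by rewrite -[i == _](inj_eq (perm_inj (s := s))) permKV.
have [g hg gh] := injF_bij hinj; split; first exact: perm_op_gate gh hg.
have sinj : injective (fun i : 'I_#|bits n| => enum_rank (g (enum_val i))).
  by move=> i j /enum_rank_inj /(can_inj gh) /enum_val_inj.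
apply/is_perm_mxP; exists (perm sinj); apply/matrixP=> i j.
rewrite !mxE mul1r permE -(inj_eq enum_val_inj) enum_rankK.
by rewrite -[enum_val i in LHS]gh (inj_eq hinj).
Qed.

Lemma affine_clifford_perm (Q : 'M['F_2]_n) (q : V) : Q \in unitmx ->
  is_clifford_perm (perm_op (fun v => v *m Q + q)).
Proof.
move=> Qu; have hinj : injective (fun v : V => v *m Q + q).
  by move=> v w /addIr /(can_inj (mulmxK Qu)).
have pg : is_perm_gate (perm_op (fun v => v *m Q + q)).
  by apply/is_perm_gateP; exists (fun v => v *m Q + q).
split=> //; apply: clifford_intertwine => [|a b]; first by case: pg.
(* Chosen so that $b'\cdot(vQ) = b\cdot v$; the translation [q] only adds the constant sign of
   $b'\cdot q$. *)
pose b' := b *m (invmx Q)^T.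
exists (sg C (dot b' q)), (a *m Q), b'; rewrite sg4; split=> //.
rewrite !mono_mul; apply: eq_mono => v /=; first by rewrite mulmxDl addrAC.
rewrite dotDr sgD {2}/b' dot_mulmxl trmxK mulmxK // mulr1 mul1r mul1r.
by rewrite mulrCA sgK mulr1.
Qed.

End Clifford.
(** * Hadamard gates on a set of qubits *)

Section Hadamard.
Variables (C : numClosedFieldType) (n : nat) (D : 'M['F_2]_n).
Hypotheses (DD : D *m D = D) (DT : D^T = D).
Local Notation V := 'rV['F_2]_n.
Let E : 'M['F_2]_n := 1%:M - D.

Let ED : E *m D = 0. Proof. by rewrite mulmxBl mul1mx DD subrr. Qed.
Let DE : D *m E = 0. Proof. by rewrite mulmxBr mulmx1 DD subrr. Qed.
Let EE : E *m E = E. Proof. by rewrite {1}/E mulmxBl mul1mx DE subr0. Qed.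
Let ET : E^T = E. Proof. by rewrite /E linearB /= trmx1 DT. Qed.
Let splitE (v : V) : v = v *m E + v *m D.
Proof. by rewrite -mulmxDr subrK mulmx1. Qed.

(** The size of the image of [D]: each row of the Hadamard gate has this many nonzero entries, all
    of the same modulus. *)
Let N := #|[set u : V | u *m E == 0]|.

(* The Hadamard gate on the qubits selected by the projection [D]. *)
Definition hadamard_entry (v w : V) : C :=
  (sqrtC N%:R)^-1 * (sg C (dot (v *m D) w) * (v *m E == w *m E)%:R).
Definition hadamard : op C n := op_of hadamard_entry.

Lemma hadamard_sym v w : hadamard_entry v w = hadamard_entry w v.
Proof.
rewrite /hadamard_entry eq_sym dot_mulmxl DT dotC; congr (_ * (_ * _)).
Qed.

Lemma card_coset (v : V) : \sum_u (v *m E == u *m E)%:R = N%:R :> C.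
Proof.
rewrite (reindex_inj (addrI v)) /= -natr_sum; congr _%:R.
rewrite /N -sum1dep_card [RHS]big_mkcond /=; apply: eq_bigr => u _.
by rewrite mulmxDl -{1}[v *m E]addr0 (inj_eq (addrI _)) [0 == _]eq_sym;
  case: (u *m E == 0).
Qed.

Lemma N_gt0 : 0 < N%:R :> C.
Proof. by rewrite ltr0n; apply/card_gt0P; exists 0; rewrite inE mul0mx. Qed.

(** Some [j] has [((v + w) *m D) 0 j = 1]; shifting [u] by the [D]-part of the basis vector [j] then
    reverses every sign, so the sum equals its opposite. *)
Lemma hadamard_orth v w : v != w -> v *m E = w *m E ->
  \sum_u sg C (dot (v *m D) u + dot (w *m D) u) * (v *m E == u *m E)%:R = 0.
Proof.
move=> vw vwE; set S := \sum_u _.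
have [j vwj] : exists j, ((v + w) *m D) 0 j = 1.
  have /existsP[j] : [exists j, ((v + w) *m D) 0 j != 0].
    rewrite -negb_forall; apply: contra vw => /forallP e.
    rewrite -subr_eq0 F2_mx_opp.
    rewrite [v + w]splitE mulmxDl vwE F2_mx_addrr add0r.
    by apply/eqP/rowP=> i; rewrite [RHS]mxE; apply/eqP.
  by exists j; case: (F2_cases (((v + w) *m D) 0 j)) p => // ->.
suff /eqP : - S = S by rewrite eqNr => /eqP.
rewrite {2}/S (reindex_inj (addIr (delta_mx 0 j *m D))) /= -sumrN.
apply: eq_bigr => u _; rewrite -!dotDl -!mulmxDl dotDr sgD.
rewrite [(u + _) *m E]mulmxDl -[_ *m D *m E]mulmxA DE mulmx0 addr0.
have -> : dot ((v + w) *m D) (delta_mx 0 j *m D) = 1.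
  by rewrite -{2}DT -dot_mulmxl -mulmxA DD dot_delta.
by rewrite sg1 mulrN1 mulNr.
Qed.

Lemma hadamard_adj : hadamard^t* = hadamard.
Proof.
rewrite adj_op_of; apply: eq_op_of => v w.
rewrite [RHS]hadamard_sym /hadamard_entry !rmorphM /= sg_conj rmorph_nat
  fmorphV.
by congr (_^-1 * _); apply/CrealP; rewrite ger0_real // sqrtC_ge0 ler0n.
Qed.

Lemma hadamard_gate : is_gate hadamard.
Proof.
apply/unitarymxP; rewrite hadamard_adj mul_op_of op_of1; apply: eq_op_of => v w.
under eq_bigr do rewrite [hadamard_entry _ w]hadamard_sym /hadamard_entry
  mulrACA -invfM -expr2 sqrtCK mulrACA -sgD.
rewrite -mulr_sumr; case: (eqVneq v w) => [<-|vw].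
  under eq_bigr do rewrite F2_addrr sg0 mul1r -natrM mulnb andbb.
  by rewrite card_coset mulVf // lt0r_neq0 // N_gt0.
case: (eqVneq (v *m E) (w *m E)) => vwE.
  under eq_bigr do rewrite -vwE -natrM mulnb andbb.
  by rewrite hadamard_orth // mulr0.
rewrite big1 ?mulr0 // => u _; case: eqP => [vu|]; last by rewrite mul0r mulr0.
by rewrite -vu eq_sym (negPf vwE) !mulr0.
Qed.

Lemma hadamard_clifford : is_clifford hadamard.
Proof.
apply: clifford_intertwine => [|a b]; first exact: hadamard_gate.
(* [X] and [Z] exponents are exchanged on the qubits of [D] and kept elsewhere. The sign [c0]
   cancels the constants produced by evaluating $Z^{b'}$ at [v + a'] and by the shift of the
   unselected qubits by [a]. *)
pose a' := a *m E + b *m D; pose b' := a *m D + b *m E.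
pose c0 := dot (b *m E) a + dot b' a'.
exists (sg C c0), a', b'; rewrite sg4; split=> //.
rewrite op_of_mono; rewrite (mono_op_of (g := +%R^~ a')) => [|v|v];
  try exact: F2_mx_addrK.
apply: eq_op_of => v w; rewrite /hadamard_entry mul1r.
have a'E : a' *m E = a *m E by rewrite mulmxDl -!mulmxA EE DE mulmx0 addr0.
have a'D : a' *m D = b *m D by rewrite mulmxDl -!mulmxA ED DD mulmx0 add0r.
have -> : ((v + a') *m E == w *m E) = (v *m E == (w + a) *m E).
  by rewrite [(v + _) *m E]mulmxDl a'E [(w + _) *m E]mulmxDl -(inj_eq (addIr (a
    *m E))) F2_mx_addrK.
case: (eqVneq (v *m E)) => [vE|]; last by rewrite !mulr0 mul0r.
have assoc (x y z t u : C) : y * z = t * u -> x * y * z = t * (x * u).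
  by move=> e; rewrite -mulrA e mulrCA.
rewrite !mulr1; apply: assoc; rewrite -!sgD; congr (sg _ _).
have bv : dot (b *m E) v = dot (b *m E) w + dot (b *m E) a.
  by rewrite -dotDr !dot_mulmxl ET vE.
have bw : dot b w = dot (b *m E) w + dot (b *m D) w by rewrite -dotDl -splitE.
rewrite [(v + _) *m D]mulmxDl a'D /c0 [dot b' (v + a')]dotDr [dot b' v]dotDl
  [dot (v *m D + _) w]dotDl [dot _ (w + a)]dotDr bw bv.
have -> : dot (a *m D) v = dot (v *m D) a by rewrite dot_mulmxl DT dotC.
set x1 := dot (v *m D) w; set x2 := dot (v *m D) a; set x3 := dot (b *m E) w.
set x4 := dot (b *m D) w; set x5 := dot (b *m E) a; set y := dot b' a'.
transitivity (x1 + x2 + (x3 + x4) + ((x5 + x5) + (y + y))); last by ring.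
by rewrite !F2_addrr !addr0.
Qed.

(* Conjugation by the Hadamard gates on the targets diagonalizes a map
   w |-> w + f w that only acts on them. *)
Lemma hadamard_shear (f : V -> V) :
  (forall w, f w *m D = f w) ->
  (forall v w, v *m E = w *m E -> f v = f w) ->
  hadamard *m perm_op C (fun w => w + f w) =
  diag_sign C (fun v => dot v (f v)) *m hadamard.
Proof.
move=> fD fE; rewrite op_of_mono (mono_op_of (g := id)) //.
apply: eq_op_of => v w; rewrite /hadamard_entry mulr1.
have fwE : f w *m E = 0 by rewrite -fD -mulmxA DE mulmx0.
rewrite mulmxDl fwE addr0; case: (eqVneq (v *m E)) => [vE|];
  last by rewrite !mulr0.
rewrite !mulr1 mulrCA -sgD dotDr addrC; congr (_ * sg C (_ + _)).
by rewrite dot_mulmxl DT fD (fE v w).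
Qed.

Lemma shear_diag (f : V -> V) :
  (forall w, f w *m D = f w) ->
  (forall v w, v *m E = w *m E -> f v = f w) ->
  perm_op C (fun w => w + f w) =
  hadamard^t* *m diag_sign C (fun v => dot v (f v)) *m hadamard.
Proof.
move=> fD fE; rewrite -mulmxA -hadamard_shear // mulmxA gate_mulKV ?mul1mx //.
exact: hadamard_gate.
Qed.

End Hadamard.
(** * Products of multi-controlled NOT gates *)

Section ControlledNot.
Variable n : nat.
Local Notation V := 'rV['F_2]_n.
Implicit Types (s : seq (mcnot n)) (g : mcnot n) (v w : V).

Definition mcnot_shift s w : V :=
  \sum_(g <- s) (\prod_(i in controls g) w 0 i) *: delta_mx 0 (target g).

Definition targets s : {set 'I_n} := [set j in map (@target n) s].

Definition qubit_mask (T : {set 'I_n}) : 'M['F_2]_n :=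
  diag_mx (\row_j (j \in T)%:R).

Lemma qubit_maskE (v : V) T j : (v *m qubit_mask T) 0 j = v 0 j * (j \in T)%:R.
Proof. by rewrite mul_mx_diag !mxE. Qed.

Lemma qubit_mask_idem T : qubit_mask T *m qubit_mask T = qubit_mask T.
Proof.
apply: eq_mulmx_rowvec => v; rewrite mulmxA; apply/rowP=> j.
by rewrite !qubit_maskE -mulrA -natrM mulnb andbb.
Qed.

Lemma qubit_mask_sym T : (qubit_mask T)^T = qubit_mask T.
Proof. exact: tr_diag_mx. Qed.

Lemma pid_mx_qubit_mask r :
  pid_mx r = qubit_mask [set j : 'I_n | (j < r)%N] :> 'M['F_2]_n.
Proof.
apply/matrixP=> i j; rewrite !mxE inE val_eqE.
by case: eqVneq => [->|]; rewrite ?mulr1n ?mulr0n.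
Qed.

Lemma qubit_mask_compl v w T :
  v *m (1%:M - qubit_mask T) = w *m (1%:M - qubit_mask T) ->
  forall j, j \notin T -> v 0 j = w 0 j.
Proof.
move=> vw j jT; have := congr1 (fun x : V => x 0 j) vw.
rewrite !mulmxBr !mulmx1 ![(_ - _ *m _) 0 j]mxE ![(- (_ *m _)) 0 j]mxE.
by rewrite !qubit_maskE (negPf jT) !mulr0 !subr0.
Qed.

Lemma targetsP s : all (fun g => target g \in targets s) s.
Proof.
have : all (fun t => t \in targets s) (map (@target n) s).
  by apply/allP=> t ts; rewrite inE.
by rewrite all_map.
Qed.

Lemma mismatch_freeP s : mismatch_free s ->
  all (fun g => [disjoint controls g & targets s]) s.
Proof.
rewrite /mismatch_free allrelC /allrel; apply: sub_all => g gs.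
have {}gs : all (fun t => t \notin controls g) (map (@target n) s) by rewrite
  all_map.
rewrite disjoint_sym; apply/pred0P=> j /=; apply/negbTE/negP=> /andP[].
by rewrite inE => /(allP gs) /negPf ->.
Qed.

Lemma mcnot_shift_off (T : {set 'I_n}) s w j :
  all (fun g => target g \in T) s -> j \notin T -> mcnot_shift s w 0 j = 0.
Proof.
move=> sT jT; rewrite summxE; elim: s sT => [|g s IH] /=;
  first by rewrite big_nil.
case/andP=> gT /IH e; rewrite big_cons e addr0 !mxE eqxx /=.
by case: eqVneq jT gT => [-> /negPf ->|]; rewrite ?mulr0.
Qed.

Lemma mcnot_shift_mask (T : {set 'I_n}) s w : all (fun g => target g \in T) s ->
  mcnot_shift s w *m qubit_mask T = mcnot_shift s w.
Proof.
move=> sT; apply/rowP=> j; rewrite qubit_maskE.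
by case: (boolP (j \in _)) => jT;
  rewrite ?mulr1 // mulr0 (mcnot_shift_off _ sT).
Qed.

Lemma eq_prod_controls (T : {set 'I_n}) g v w : [disjoint controls g & T] ->
  (forall j, j \notin T -> v 0 j = w 0 j) ->
  \prod_(i in controls g) v 0 i = \prod_(i in controls g) w 0 i.
Proof.
move=> gT vw; apply: eq_bigr => i ig; apply: vw; apply/negP=> iT.
by move/pred0P/(_ i): gT => /=; rewrite ig iT.
Qed.

Lemma mcnot_shift_indep (T : {set 'I_n}) s v w :
  all (fun g => [disjoint controls g & T]) s ->
  (forall j, j \notin T -> v 0 j = w 0 j) -> mcnot_shift s v = mcnot_shift s w.
Proof.
rewrite /mcnot_shift => sT vw; elim: s sT => [|g s IH] /=;
  first by rewrite !big_nil.
by case/andP=> gT /IH e; rewrite !big_cons e (eq_prod_controls gT vw).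
Qed.

Lemma mcnot_funE g v :
  mcnot_fun g v = v + (\prod_(i in controls g) v 0 i) *: delta_mx 0 (target g).
Proof.
by apply/rowP=> j; rewrite !mxE eqxx /=; case: eqP; rewrite ?mulr1 ?mulr0.
Qed.

(** No gate alters a control, so every gate sees the original control values and the shifts add
    up. *)
Lemma mcnot_prodE (C : numClosedFieldType) s : mismatch_free s ->
  mcnot_prod C s = perm_op C (fun w => w + mcnot_shift s w).
Proof.
(* The target set is generalized to a fixed [T], so that it does not shrink with the list during the
   induction. *)
move=> /mismatch_freeP; have := targetsP s; move: (targets s) => T.
rewrite /mcnot_prod; elim: s => [_ _|g s IH] /=.
  rewrite big_nil -mono1; apply: eq_mono => // w.
  by rewrite /mcnot_shift big_nil addr0.
case/andP=> gT sT /andP[gc sc]; rewrite big_cons IH //.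
have -> : mcnot_gate C g = perm_op C (mcnot_fun g).
  by apply: eq_op_of => v w; rewrite mul1r.
rewrite perm_opM; apply: eq_perm_op => w /=.
rewrite mcnot_funE (eq_prod_controls (w := w) gc) => [|j jT].
  by rewrite /mcnot_shift big_cons -addrA [\sum_(_ <- s) _ + _]addrC.
by rewrite mxE (mcnot_shift_off _ sT jT) addr0.
Qed.

(** Each gate contributes its target coordinate times the monomial of its controls, hence the extra
    degree. *)
Lemma mcnot_shift_deg k s : all (fun g => #|controls g| <= k)%N s ->
  deg_le k.+1 (fun v => dot v (mcnot_shift s v)).
Proof.
elim: s => [_|g s IH].
  by apply: eq_deg_le (deg_le_const n k.+1 0) => v;
    rewrite /mcnot_shift big_nil dot0r.
rewrite [all _ _]/= => /andP[gk /IH sk].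
apply: eq_deg_le (deg_leD (deg_le_coordM (target g) (deg_le_monomial gk)) sk)
  => v.
rewrite /mcnot_shift big_cons dotDr; congr (_ + _).
by rewrite [RHS]/dot linearZ /= -scalemxAr mxE -/(dot _ _) dot_delta mulrC.
Qed.

Lemma mcnot_seq_exists (ps : seq ('I_n * {set 'I_n})) :
  all (fun p : 'I_n * {set 'I_n} => p.1 \notin p.2) ps ->
  exists s, [seq (target g, controls g) | g <- s] = ps.
Proof.
elim: ps => [|[t K] ps IH] /=; first by exists [::].
by case/andP=> tK /IH[s <-]; exists (MCNot tK :: s).
Qed.

End ControlledNot.

(** * Semi-Clifford permutations *)

Section Main.
Variables (C : numClosedFieldType) (n : nat).
Local Notation V := 'rV['F_2]_n.
Implicit Types (h f : V -> V).

(** Hadamard gates on the targets diagonalize the product, and are absorbed into the outer Clifford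
    factors. *)
Lemma mcnot_prod_semi_clifford k (phi1 phi2 : op C n) s :
  is_clifford phi1 -> is_clifford phi2 -> mismatch_free s ->
  all (fun g => #|controls g| <= k.+1)%N s ->
  let U := phi1 *m mcnot_prod C s *m phi2 in
  is_semi_clifford U /\ clifford_level k.+2 U.
Proof.
move=> c1 c2 ms sk /=; have sT := targetsP s; have sc := mismatch_freeP ms.
pose D := qubit_mask (targets s).
have Hc : is_clifford (hadamard C D).
  by apply: hadamard_clifford; rewrite ?qubit_mask_idem ?qubit_mask_sym.
rewrite mcnot_prodE // (@shear_diag _ _ D) ?qubit_mask_idem ?qubit_mask_sym //;
  first last.
- by move=> v w /qubit_mask_compl; apply: mcnot_shift_indep.
- by move=> w; apply: mcnot_shift_mask.
set d := diag_sign C _; set H := hadamard C D in Hc *.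
have dl : clifford_level k.+2 d by apply/diag_sign_level/mcnot_shift_deg.
split; last first.
  by apply: level_mulr => //; apply: level_mull => //; apply: level_mulr => //;
     apply: level_mull => //; apply: clifford_adj.
exists (phi1 *m H^t*), d, (H *m phi2); split; last by rewrite !mulmxA.
- by apply: cliffordM => //; apply: clifford_adj.
- exact: diag_sign_diag.
- exact: cliffordM.
Qed.

Lemma pauli1_is_pauli a b : is_pauli (pauli (1 : C) a b : op C n).
Proof. by apply/is_pauliP; exists 1, a, b; rewrite expr1n. Qed.

(** Conjugation preserves commutation signs, and these can be read off because Pauli operators are
    nonzero. *)
Lemma conj_symplectic (U : op C n) a1 b1 a2 b2 c1 x1 z1 c2 x2 z2 :
  is_gate U -> c1 ^+ 4 = 1 -> c2 ^+ 4 = 1 ->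
  U *m pauli 1 a1 b1 *m U^t* = pauli c1 x1 z1 ->
  U *m pauli 1 a2 b2 *m U^t* = pauli c2 x2 z2 ->
  dot b1 a2 + dot a1 b2 = dot z1 x2 + dot x1 z2.
Proof.
move=> Ug c14 c24 e1 e2; apply: (@sg_inj C).
have := pauliC c1 c2 x1 x2 z1 z2.
have mulE P P' : U *m P *m U^t* *m (U *m P' *m U^t*) = U *m (P *m P') *m U^t*.
  by rewrite !mulmxA gate_mulVK.
rewrite -{1}e1 -{1}e2 mulE pauliC -scalemxAr -scalemxAl -mulE e1 e2.
move/eqP; rewrite -subr_eq0 -scalerBl scaler_eq0 => /orP[|].
  by rewrite subr_eq0 => /eqP.
by rewrite pauliM (negPf (pauli_neq0 _ _ _)) // !exprMn c14 c24 sg4 !mulr1.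
Qed.

(** $d$ commutes with $Z^b$, so $U\phi_2^\dagger Z^b\phi_2 = \phi_1 Z^b d\phi_2 = (\phi_1
    Z^b\phi_1^\dagger)U$. *)
Lemma diag_conj_pauliZ (U phi1 d phi2 : op C n) (b : V) c c' x x' z z' :
  is_clifford phi1 -> is_diag_gate d -> is_clifford phi2 ->
  U = phi1 *m d *m phi2 ->
  phi1 *m pauli 1 0 b *m phi1^t* = pauli c' x' z' ->
  phi2^t* *m pauli 1 0 b *m phi2 = pauli c x z ->
  U *m pauli c x z = pauli c' x' z' *m U.
Proof.
move=> c1 [dg /is_diag_mxP dd] c2 -> <- <-.
have g1 := level_gate (m := 2) c1; have g2 := level_gate (m := 2) c2.
have dZ : d *m pauli 1 0 b = pauli 1 0 b *m d.
  rewrite (op_ofP d) op_of_mono (mono_op_of (g := id)) => [|v|v];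
    rewrite ?addr0 //.
  apply: eq_op_of => v w; rewrite addr0.
  case: (eqVneq v w) => [->|vw]; first by rewrite mulrC.
  by rewrite dd ?mulr0 ?mul0r // (inj_eq val_inj) (inj_eq enum_rank_inj).
rewrite !mulmxA (gate_mulVK _ g1) -[_ *m phi2 *m phi2^t*]mulmxA.
by rewrite (unitarymxP _) // mulmx1 -[_ *m d *m _]mulmxA dZ !mulmxA.
Qed.

Lemma mul_rows_trE (s s' : 'I_n -> V) i j :
  ((\matrix_(i < n) s i) *m (\matrix_(i < n) s' i)^T) i j = dot (s i) (s' j).
Proof. by rewrite mxE dot_sum; apply: eq_bigr => l _; rewrite !mxE. Qed.

(* Conjugating the Z_i by phi2^-1 gives Paulis X^(row i M) Z^(row i N), which
   [perm_op h] carries to the Paulis X^(row i M') Z^(row i N') obtained by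
   conjugating the Z_i by phi1. The rows of (M | N) are isotropic because the
   Z_i commute, and independent because each Z_i fails to commute with X_i. *)
Lemma semi_clifford_stabilizer h : injective h ->
  is_semi_clifford (perm_op C h) ->
  exists M N M' N' : 'M['F_2]_n,
  [/\ forall v c, h (v + c *m M) = h v + c *m M',
      forall v, v *m N^T = h v *m N'^T + h 0 *m N'^T,
      M *m N^T = N *m M^T
    & forall c : V, c *m M = 0 -> c *m N = 0 -> c = 0].
Proof.
move=> hinj [phi1 [d [phi2 [c1 dd c2 he]]]].
have c2' := clifford_adj c2; have g2' := level_gate (m := 2) c2'.
pose e (i : 'I_n) : V := delta_mx 0 i.
have conjP (phi : op C n) : is_clifford phi -> forall a b : 'I_n -> V,
    exists t : 'I_n -> C * V * V, forall i, (t i).1.1 ^+ 4 = 1 /\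
      phi *m pauli 1 (a i) (b i) *m phi^t* = pauli (t i).1.1 (t i).1.2 (t i).2.
  move=> pc a b; apply: (fin_all_exists (P := fun i (t : C * V * V) =>
    t.1.1 ^+ 4 = 1 /\
    phi *m pauli 1 (a i) (b i) *m phi^t* = pauli t.1.1 t.1.2 t.2)) => i.
  have /is_pauliP[c [x [z [c4 ->]]]] := pc.2 _ (pauli1_is_pauli (a i) (b i)).
  by exists (c, x, z).
have [t tP] := conjP _ c2' (fun=> 0) e.
have [t' t'P] := conjP _ c1 (fun=> 0) e.
have [u uP] := conjP _ c2' e (fun=> 0).
pose M := \matrix_(i < n) (t i).1.2; pose N := \matrix_(i < n) (t i).2.
pose M' := \matrix_(i < n) (t' i).1.2; pose N' := \matrix_(i < n) (t' i).2.
(* Both sides of the intertwining relation are monomial operators; their basis maps and their phases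
   are compared separately. *)
have inter i : (forall w, h (w + (t i).1.2) = h w + (t' i).1.2) /\
    forall w, (t i).1.1 * sg C (dot (t i).2 w) =
      (t' i).1.1 * sg C (dot (t' i).2 (h w)).
  have [ti4 tie] := tP i; have [t'i4 t'ie] := t'P i.
  rewrite trmxCK in tie; have := diag_conj_pauliZ c1 dd c2 he t'ie tie.
  rewrite !mono_mul => /monomial_inj[w|hh ss];
    first by rewrite mul1r mulf_neq0 ?sg_neq0 ?phase4_neq0.
  by split=> // w; have := ss w; rewrite mul1r mulr1.
exists M, N, M', N'; split.
- move=> v c; rewrite !mulmx_sum_row; move: v.
  elim/big_ind2: _ => [v|x1 x2 y1 y2 IH1 IH2 v|i _ v]; first by rewrite !addr0.
    by rewrite addrA IH2 IH1 addrA.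
  case: (F2_cases (c 0 i)) => ->; first by rewrite !scale0r !addr0.
  by rewrite !scale1r !rowK (inter i).1.
- move=> v; apply/rowP=> i.
  have rowE' (w : V) (s : 'I_n -> V) :
      (w *m (\matrix_(i < n) s i)^T) 0 i = dot (s i) w.
    by rewrite mxE dotC dot_sum; apply: eq_bigr => j _; rewrite !mxE.
  rewrite [RHS]mxE !rowE'; apply: (@sg_inj C).
  (* Comparison with the phase relation at 0 eliminates the unknown phases. *)
  have [[t4 _] [_ te]] := (t'P i, inter i).
  have := te v; have := te 0; rewrite dot0r sg0 mulr1 => ->.
  rewrite -mulrA => /(mulfI (phase4_neq0 t4)) => ev.
  by rewrite addrC sgD -ev mulrA sgK mul1r.
- apply/matrixP=> i j.
  have := conj_symplectic g2' (tP i).1 (tP j).1 (tP i).2 (tP j).2.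
  rewrite dot0r dot0l addr0 => /esym ij.
  rewrite !mul_rows_trE; move/eqP: ij; rewrite addrC addr_eq0 => /eqP ->.
  by apply/eqP; rewrite eq_sym -addr_eq0 F2_addrr.
move=> c cM cN.
(* The conjugated $Z_i$ and $X_j$ anticommute exactly when $i=j$, which gives (M | N) a right
   inverse. *)
have id1 : N *m (\matrix_(j < n) (u j).1.2)^T +
    M *m (\matrix_(j < n) (u j).2)^T = 1%:M.
  apply/matrixP=> i j; rewrite mxE !mul_rows_trE.
  have := conj_symplectic g2' (tP i).1 (uP j).1 (tP i).2 (uP j).2.
  by rewrite dot0r addr0 => <-; rewrite dot_delta !mxE eqxx eq_sym.
by rewrite -[c]mulmx1 -id1 mulmxDr !mulmxA cM cN !mul0mx addr0.
Qed.

(** As [g] is its own inverse, conjugating $Z_j$ gives the diagonal gate with signs $(-1)^{g(v)_j}$,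
    one level lower. *)
Lemma involution_level_deg m (g : V -> V) : cancel g g ->
  clifford_level m.+2 (perm_op C g) ->
  forall j, deg_le m.+1 (fun v => g v 0 j).
Proof.
move=> gg gl j; have := level_pauli_conj gl (pauli1_is_pauli 0 (delta_mx 0 j)).
rewrite (perm_op_adj C gg gg) !mono_mul => Zl; apply/(@diag_sign_level C).
have -> : diag_sign C (fun v => g v 0 j) = mono
    ((g \o +%R^~ 0) \o g) (fun w => 1 * (1 * sg C (dot (delta_mx 0 j) (g w))) *
      1).
  by apply: eq_mono => v /=; rewrite ?addr0 ?gg // !mul1r mulr1 dot_deltal.
exact: Zl.
Qed.

Lemma shear_mcnots k (T : {set 'I_n}) f :
  (forall v j, j \notin T -> f v 0 j = 0) ->
  (forall v w : V, (forall j, j \notin T -> v 0 j = w 0 j) -> f v = f w) ->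
  (forall j, deg_le k (fun v => f v 0 j)) ->
  exists s : seq (mcnot n),
    [/\ mismatch_free s, all (fun g => #|controls g| <= k)%N s
    & forall v, mcnot_shift s v = f v].
Proof.
move=> fT fI fk.
have anf j : exists Ss : seq {set 'I_n},
    (forall S, S \in Ss -> {subset S <= enum (~: T)} /\ (#|S| <= k)%N) /\
    forall v, f v 0 j = \sum_(S <- Ss) \prod_(i in S) v 0 i.
  (* Flipping a coordinate in [T] leaves [f] unchanged, so the monomials use only variables outside
     [T]. *)
  apply: anf_exists (enum_uniq _) (fk j) _ => i;
    rewrite mem_enum inE negbK => iT v.
  congr (fun x : V => x 0 j); apply: fI => l lT; rewrite !mxE eqxx /=.
  by case: eqVneq lT => [->|]; rewrite ?iT ?addr0.
have {anf}[Ss SsP] := fin_all_exists anf.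
(* One gate for each monomial [K] of each target component [j]. *)
pose ps := [seq (j, K) | j <- enum T, K <- Ss j].
have psP p : p \in ps -> [/\ p.1 \in T, [disjoint p.2 & T] & (#|p.2| <= k)%N].
  move=> /allpairsPdep[j [S [jT SS ->]]] /=; rewrite mem_enum in jT.
  have [Sl Sk] := (SsP j).1 _ SS; split=> //.
  apply/pred0P=> i /=; apply/negbTE/negP=> /andP[/Sl].
  by rewrite mem_enum inE => /negPf ->.
have off p q : p \in ps -> q \in ps -> p.1 \notin q.2.
  move=> /psP[pT _ _] /psP[_ /pred0P/(_ p.1) /= qT _].
  by move: qT; rewrite pT andbT => ->.
have [|s sps] := @mcnot_seq_exists n ps; first by apply/allP=> p pp; apply: off.
exists s; split.
- have : allrel (fun p q : 'I_n * {set 'I_n} => p.1 \notin q.2) ps ps by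
  apply/allrelP.
  by rewrite -sps allrel_mapl allrel_mapr.
- have : all (fun p : 'I_n * {set 'I_n} => #|p.2| <= k)%N ps by apply/allP=> p
  /psP[].
  by rewrite -sps all_map.
move=> v; transitivity
  (\sum_(p <- ps) (\prod_(i in p.2) v 0 i) *: delta_mx 0 p.1 : V).
  by rewrite -sps big_map.
rewrite big_allpairs_dep /= big_enum /= [RHS]row_sum_delta [RHS](bigID (mem T))
  /=.
rewrite [X in _ + X]big1 ?addr0 => [|j jT]; last by rewrite fT // scale0r.
by apply: eq_bigr => j _; rewrite (SsP j).2 scaler_suml.
Qed.

Lemma semi_clifford_mcnot_prod k h : injective h ->
  is_semi_clifford (perm_op C h) -> clifford_level k.+2 (perm_op C h) ->
  exists (phi1 phi2 : op C n) (s : seq (mcnot n)),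
    [/\ is_clifford_perm phi1, is_clifford_perm phi2, mismatch_free s,
        all (fun g => #|controls g| <= k.+1)%N s
      & perm_op C h = phi1 *m mcnot_prod C s *m phi2].
Proof.
move=> hinj hsc hl.
have [M [N [M' [N' [hM hN MN inj]]]]] := semi_clifford_stabilizer hinj hsc.
have [r [Q1 [Q2 [q]]]] := normal_form hinj hM hN MN inj.
rewrite pid_mx_qubit_mask; set T := [set j | _]; set D := qubit_mask T.
set g := fun u => _; case=> Q1u Q2u gE gD.
pose f u := g u + u.
have gf u : g u = u + f u by rewrite /f addrC F2_mx_addrK.
have fE u : f u *m (1%:M - D) = 0 by rewrite mulmxDl gE F2_mx_addrr.
have fT u j : j \notin T -> f u 0 j = 0.
  move=> jT; rewrite (qubit_mask_compl (w := 0) _ jT) ?mxE //.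
  by rewrite fE mul0mx.
have fI (u w : V) : (forall j, j \notin T -> u 0 j = w 0 j) -> f u = f w.
  (* The two points differ by a translation along [D], with which [g] commutes. *)
  move=> uw; have -> : w = u + (u + w) *m D.
    apply/rowP=> j; rewrite mxE qubit_maskE mxE.
    case: (boolP (j \in T)) => jT; first by rewrite mulr1 addrA F2_addrr add0r.
    by rewrite mulr0 addr0 uw.
  by rewrite /f gD addrACA F2_mx_addrr addr0.
(* [g] fixes the coordinates on which [f] depends, so applying it twice adds [f u] twice. *)
have gg : cancel g g.
  move=> u; rewrite [g (g u)]gf (fI (g u) u) 1?gf ?F2_mx_addrK // => j jT.
  by rewrite mxE fT // addr0.
have gl : clifford_level k.+2 (perm_op C g).
  (* [g] arises from [h] by composition with affine maps, which are Clifford, so the level is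
     unchanged. *)
  have -> : perm_op C g = perm_op C (fun v : V => v *m Q1 + q) *m perm_op C h *m
      perm_op C (fun v : V => v *m Q2 + 0).
    by rewrite !perm_opM; apply: eq_perm_op => v /=; rewrite addr0.
  apply: level_mulr; first exact: (affine_clifford_perm C 0 Q2u).2.
  by apply: level_mull => //; exact: (affine_clifford_perm C q Q1u).2.
have fk j : deg_le k.+1 (fun v => f v 0 j).
  apply: eq_deg_le (deg_leD (involution_level_deg gg gl j) (deg_le_coord j
    (ltn0Sn k))).
  by move=> v; rewrite /f [in RHS]mxE.
have [s [ms sk sf]] := shear_mcnots fT fI fk.
(* These affine maps invert the coordinate changes; the sign of the translation part disappears in
   characteristic 2. *)
exists (perm_op C (fun v : V => v *m invmx Q1 + q *m invmx Q1)),
  (perm_op C (fun v : V => v *m invmx Q2 + 0)), s; split=> //;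
  try by apply: affine_clifford_perm; rewrite unitmx_inv.
rewrite mcnot_prodE // !perm_opM; apply: eq_perm_op => v /=.
by rewrite sf -gf addr0 /g mulmxKV // -mulmxDl F2_mx_addrK mulmxK.
Qed.

End Main.

Theorem theoremB5 (R : realType) (n k : nat) (hk : (0 < k)%N)
    (pi : op R[i] n) (hpi : is_perm_gate pi) :
  (is_semi_clifford pi /\ clifford_level k.+1 pi) <->
  (exists (phi1 phi2 : op R[i] n) (s : seq (mcnot n)),
     [/\ is_clifford_perm phi1, is_clifford_perm phi2,
         mismatch_free s,
         all (fun g => #|controls g| <= k)%N s
       & pi = phi1 *m mcnot_prod R[i] s *m phi2]).
Proof.
(* Writing [k] as a successor puts the level at 2 or more, where multiplication by Clifford gates
   preserves it. *)
case: k hk => [//|k] _; split.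
  have [h [hinj ->]] := (is_perm_gateP pi).1 hpi.
  by case; apply: semi_clifford_mcnot_prod.
case=> phi1 [phi2 [s [[_ c1] [_ c2] ms sk ->]]].
exact: mcnot_prod_semi_clifford.
Qed.
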